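(* Let $(A,\sigma,u,\Lambda)$ be a semiperfect unitary ring and let $(P,[\beta])$ be a (not necessarily unimodular) quadratic space over it. Let $Q,S,V$ be summands of $P$, and let $\psi:(Q,[\beta|_Q])\to(S,[\beta|_S])$ be an isometry. Assume that (1a) $L_Q(V)=Q^*$ and $L_S(V)=S^*$, and (1b) $\psi x-x\in V$ for all $x\in Q$. Then $\psi$ extends to an isometry $\varphi\in O(P,[\beta])$ such that $\varphi x-x\in V$ for all $x\in P$.
   Context: Rings are associative and unital. An anti-structure on a ring $A$ is a pair $(\sigma,u)$ where $\sigma:A\to A$, $a\mapsto a^\sigma$, is an anti-automorphism and $u\in A^\times$ satisfies $u^\sigma u=1$ and $a^{\sigma\sigma}=uau^{-1}$ for all $a$. Put $\Lambda^{\min}=\{a-a^\sigma u: a\in A\}$, $\Lambda^{\max}=\{a\in A: a^\sigma u=-a\}$. A form parameter is an additive group $\Lambda$ with $\Lambda^{\min}\subseteq\Lambda\subseteq\Lambda^{\max}$ and $a^\sigma\Lambda a\subseteq\Lambda$ for all $a\in A$; then $(A,\sigma,u,\Lambda)$ is called a unitary ring. It is called semiperfect if $A$ is semiperfect, i.e. $A$ is semilocal and idempotents lift modulo $\mathrm{Jac}(A)$. Let $\mathcal{P}(A)$ be the category of finitely generated projective right $A$-modules. For $P\in\mathcal{P}(A)$, $P^*=\mathrm{Hom}_A(P,A)$ is a right $A$-module via $(fa)(x)=a^\sigma f(x)$. A sesquilinear form on $P$ is a biadditive $\beta:P\times P\to A$ with $\beta(xa,yb)=a^\sigma\beta(x,y)b$;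 these form an abelian group $\mathcal{S}_P$. $\Lambda_P\subseteq\mathcal{S}_P$ is the subgroup of all $\gamma$ with $\gamma(x,y)=-\gamma(y,x)^\sigma u$ and $\gamma(x,x)\in\Lambda$ for all $x,y$. A quadratic space is a pair $(P,[\beta])$ with $P\in\mathcal{P}(A)$ and $[\beta]\in\mathcal{S}_P/\Lambda_P$. Set $h_\beta(x,y)=\beta(x,y)+\beta(y,x)^\sigma u$ (it depends only on $[\beta]$). An isometry $(P,[\beta])\to(P',[\beta'])$ is an $A$-module isomorphism $\psi$ with $[\beta'(\psi\cdot,\psi\cdot)]=[\beta]$; $O(P,[\beta])$ is the group of isometries of $(P,[\beta])$ to itself. For a submodule $Q\subseteq P$, $\beta|_Q$ is the restriction of $\beta$ to $Q\times Q$ and $L_Q:P\to Q^*$ is $x\mapsto[y\mapsto h_\beta(x,y)]$. *)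

(* Defs.v *)
From HB Require Import structures.
From mathcomp Require Import all_boot all_order all_algebra.
From mathcomp Require Import boolp classical_sets.

Set Implicit Arguments.
Unset Strict Implicit.
Unset Printing Implicit Defensive.

Import GRing.Theory.
Local Open Scope classical_set_scope.
Local Open Scope ring_scope.

(* A right A-module is a left module over the converse ring A^c.  Submodules
   are boolean predicates (submodClosed); since every proposition is reflected
   by a boolean in boolp, these are all the submodules.  A^c^o is A as a right
   module over itself, so its submodules are the right ideals of A. *)

Definition ract (A : pzRingType) (M : lmodType A^c) (x : M) (a : A) : M :=
  (a : A^c) *: x.

Section Submodules.
Context (K : pzRingType) (M : lmodType K).

Definition submod (Q : submodClosed M) : Type := {x : M | x \in Q}.
HB.instance Definition _ (Q : submodClosed M) := SubChoice.on (submod Q).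
HB.instance Definition _ (Q : submodClosed M) :=
  [SubChoice_isSubLmodule of submod Q by <:].

Definition is_summand (Q : submodClosed M) : Prop :=
  exists Q' : submodClosed M,
    (forall x, exists y z, [/\ y \in Q, z \in Q' & x = y + z]) /\
    (forall x, x \in Q -> x \in Q' -> x = 0).

Definition semisimple_module : Prop :=
  forall Q : submodClosed M, is_summand Q.

Definition finitely_generated : Prop :=
  exists (n : nat) (e : 'I_n -> M),
    forall x, exists c : 'I_n -> K, x = \sum_i c i *: e i.

Definition projective : Prop :=
  forall (N N' : lmodType K) (g : {linear N -> N'}) (f : {linear M -> N'}),
    (forall y, exists x, g x = y) ->
    exists h : {linear M -> N}, forall x, g (h x) = f x.

Definition fg_projective : Prop := finitely_generated /\ projective.

End Submodules.

Section Semiperfect.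
Context (A : pzRingType).

Definition maximal_right_ideal (I : submodClosed A^c^o) : Prop :=
  (exists a : A, a \notin I) /\
  forall J : submodClosed A^c^o,
    {subset I <= J} -> (exists a : A, a \notin J) -> {subset J <= I}.

Definition Jac : set A :=
  [set a | forall I : submodClosed A^c^o, maximal_right_ideal I -> a \in I].

(* (B, pi) is a model of the quotient ring A / Jac(A). *)
Definition semilocal : Prop :=
  exists (B : pzRingType) (pi : {rmorphism A -> B}),
    [/\ forall b, exists a, pi a = b,
        forall a, pi a = 0 <-> Jac a
      & semisimple_module B^c^o].

Definition idempotents_lift_mod_Jac : Prop :=
  forall e : A, Jac (e * e - e) -> exists2 f : A, f * f = f & Jac (f - e).

Definition semiperfect : Prop := semilocal /\ idempotents_lift_mod_Jac.

End Semiperfect.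

Section UnitaryRings.
Context (A : pzRingType) (sigma : A -> A) (u : A).

Definition is_anti_automorphism : Prop :=
  [/\ bijective sigma,
      forall a b, sigma (a + b) = sigma a + sigma b,
      sigma 1 = 1
    & forall a b, sigma (a * b) = sigma b * sigma a].

Definition is_anti_structure : Prop :=
  [/\ is_anti_automorphism,
      sigma u * u = 1
    & exists u' : A, [/\ u * u' = 1, u' * u = 1
                       & forall a, sigma (sigma a) = u * a * u']].

Definition Lambda_min : set A := [set a - sigma a * u | a in [set: A]].
Definition Lambda_max : set A := [set a | sigma a * u = - a].

Definition is_form_parameter (Lambda : zmodClosed A) : Prop :=
  [/\ Lambda_min `<=` [set` Lambda],
      [set` Lambda] `<=` Lambda_max
    & forall a l : A, l \in Lambda -> sigma a * l * a \in Lambda].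

Definition is_unitary_ring (Lambda : zmodClosed A) : Prop :=
  is_anti_structure /\ is_form_parameter Lambda.

End UnitaryRings.

Section Forms.
Context (A : pzRingType) (sigma : A -> A) (u : A) (Lambda : zmodClosed A).

Definition is_sesquilinear (M : lmodType A^c) (beta : M -> M -> A) : Prop :=
  [/\ forall x x' y, beta (x + x') y = beta x y + beta x' y,
      forall x y y', beta x (y + y') = beta x y + beta x y'
    & forall x y a b, beta (ract x a) (ract y b) = sigma a * beta x y * b].

Definition Lambda_form (M : lmodType A^c) (gamma : M -> M -> A) : Prop :=
  [/\ is_sesquilinear gamma,
      forall x y, gamma x y = - (sigma (gamma y x) * u)
    & forall x, gamma x x \in Lambda].

(* [beta] = [beta'] in S_M / Lambda_M. *)
Definition same_class (M : lmodType A^c) (beta beta' : M -> M -> A) : Prop :=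
  Lambda_form (fun x y => beta x y - beta' x y).

Definition is_isometry (M M' : lmodType A^c) (beta : M -> M -> A)
    (beta' : M' -> M' -> A) (psi : {linear M -> M'}) : Prop :=
  bijective psi /\ same_class (fun x y => beta' (psi x) (psi y)) beta.

Definition hform (M : lmodType A^c) (beta : M -> M -> A) (x y : M) : A :=
  beta x y + sigma (beta y x) * u.

Definition restr (M : lmodType A^c) (Q : submodClosed M) (beta : M -> M -> A) :
    submod Q -> submod Q -> A :=
  fun x y => beta (val x) (val y).

(* The underlying set of M^*: in A^c^o, a *: b is b * a computed in A. *)
Definition module_dual (M : lmodType A^c) : set (M -> A) :=
  [set f | linear (f : M -> A^c^o)].

Definition Lmap (M : lmodType A^c) (beta : M -> M -> A) (Q : submodClosed M)
    (x : M) : submod Q -> A :=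
  fun y => hform beta x (val y).

End Forms.

Arguments restr {A M} Q beta _ _.
Arguments Lmap {A} sigma u {M} beta Q x _.
Arguments module_dual {A} M.

(* Main.v *)
Require Import Defs.
From HB Require Import structures.
From mathcomp Require Import all_boot all_order all_algebra.
From mathcomp Require Import boolp classical_sets.
Import GRing.Theory.
Local Open Scope classical_set_scope.
Local Open Scope ring_scope.

(** The isometry is built from explicit reflections, one local idempotent at
a time; write h for hform.

Reflections.  Let i : W -> P be linear and let w be a sesquilinear form on W
that represents the same quadratic class as the pullback of beta along i.  If
w is unimodular, there is a unique t : P -> W with w(x, t z) = h(i x, z) for
all x, and z |-> z - i(t z) is an isometry of P.  This is Wall's
parametrisation of isometries by forms on the image of 1 - phi, except that i
need not be injective and h may be degenerate (unimodular_reflection).  Such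
an isometry changes every vector by an element of the image of i and fixes
every vector orthogonal to that image.

Rank one.  Let e be an idempotent with e A e local, let q and s in P e have
the same quadratic value, put d = q - s, and let v1, v2 satisfy h(v1, q) = e =
h(v2, s).  If h(d, q) is an isomorphism from e A to the dual module, the
reflection with W = e A, i e = d and w(e, e) = h(d, q) sends q to s.  If it is
not, add one vector v that pairs invertibly with both q and s; after cutting
down to the corner dual to e, one of v1, v2 and v1 - v2 does.  The form with matrix (h(d, q), - h(s, v); h(v, q), beta(v, v))
is then unimodular, since its off-diagonal entries are invertible and locality
of e A e makes the Schur complement invertible.  Its reflection again sends q
to s (extension_rank_one).  The rank of W, one or two, adapts to the isometry,
so neither a small residue field nor a parity invariant is an obstruction.

Induction.  A summand Q has a finite dual basis (x_k, f_k) with x_k in Q e_k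
and f_k in e_k Q^* for local idempotents e_k (local_dual_basis).  In the local
ring e_0 A e_0 either f_0(x_0) or e_0 - f_0(x_0) is invertible.  In the second
case x_0 is a combination of the other x_k and is dropped.  In the first case
x_0 A splits off.  By induction some isometry phi1 is correct on the
complement, and a rank-one isometry phi2 carries phi1(x_0) to psi(x_0).  The
vector d lies in V and is orthogonal to the image of the complement because
psi and phi1 preserve h; as V maps onto Q^* and onto S^*, the vectors v1 and v2
can be chosen with the same two properties.  Hence phi2 does not disturb what
phi1 achieved (extension_on_span).

Local idempotents.  Semiperfectness enters only through the fact that the
two-sided ideal generated by the local idempotents is A
(semiperfect_local_ideal1). *)

(** * Right ideals and the Jacobson radical *)

Lemma submod_of_prop (K : pzRingType) (M : lmodType K) (X : M -> Prop) :
  X 0 -> (forall c x y, X x -> X y -> X (c *: x + y)) ->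
  exists Q : submodClosed M, forall x, x \in Q <-> X x.
Proof.
move=> X0 Xlin; pose q : {pred M} := [pred x | `[< X x >]].
have qc : submod_closed q.
  split=> [|c x y /asboolP Xx /asboolP Xy]; first exact/asboolP.
  exact/asboolP/Xlin.
pose HQ := GRing.isSubmodClosed.Build K M q (GRing.submod_closed_semi qc).
pose Q : submodClosed M := HB.pack q HQ.
by exists Q => x; split=> [/asboolP|Xx] //; apply/asboolP.
Qed.

Section IdealClosure.
Context {A : pzRingType} (I : submodClosed A^c^o).

Lemma ideal_add (a b : A) :
  (a : A^c^o) \in I -> (b : A^c^o) \in I -> (a + b : A^c^o) \in I.
Proof. exact: rpredD. Qed.

Lemma ideal_mul (a b : A) :
  (a : A^c^o) \in I -> (a * b : A^c^o) \in I.
Proof. by move=> aI; exact: (@rpredZ A^c A^c^o I (b : A^c) a aI). Qed.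

Lemma ideal_sub (a b : A) :
  (a : A^c^o) \in I -> (b : A^c^o) \in I -> (a - b : A^c^o) \in I.
Proof.
move=> aI bI; apply: ideal_add => //.
by rewrite -[b]mulr1 -mulrN; exact: ideal_mul.
Qed.

End IdealClosure.

Section RightIdeals.
Context {A : pzRingType}.

(** Zorn's lemma is applied to the sets X whose union with I is a proper right
ideal, rather than to the ideals containing I, so that the empty chain needs no
separate upper bound. *)
Lemma proper_sub_maximal (I : submodClosed A^c^o) :
  (1 : A^c^o) \notin I ->
  exists2 N : submodClosed A^c^o, maximal_right_ideal N & {subset I <= N}.
Proof.
move=> I1.
pose C (X : set A^c^o) :=
  [/\ X 0, (forall c x y, X x -> X y -> X (c *: x + y)) & ~ X 1].
have CI : C [set` I].
  split=> /= [|c x y xI yI|]; [exact: rpred0| |exact/negP].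
  by apply: rpredD => //; exact: rpredZ.
have [F FP Ftot|X [CX Xmax]] := @Zorn_bigcup _ (fun X => C ([set` I] `|` X)).
  split=> [|c x y Hx Hy|[|[X FX X1]]].
  - by left; exact: rpred0.
  - have [Z [HZ Zx Zy]] : exists Z : set A^c^o, [/\ Z = set0 \/ F Z,
        ([set` I] `|` Z) x & ([set` I] `|` Z) y].
      move: Hx Hy => [Ix|[X FX Xx]] [Iy|[Y FY Yy]].
      + by exists set0; split; left.
      + by exists Y; split; [right|left|right].
      + by exists X; split; [right|right|left].
      + case: (Ftot _ _ FX FY) => [XY|YX].
          by exists Y; split; [right|right; exact: XY|right].
        by exists X; split; [right|right|right; exact: YX].
    have [_ /(_ c x y Zx Zy) + _] : C ([set` I] `|` Z).
      by case: HZ => [->|/FP //]; rewrite setU0.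
    case=> [|Zxy]; first by left.
    by case: HZ => [Z0|FZ]; [rewrite Z0 in Zxy|right; exists Z].
  - exact/negP.
  - by have [_ _] := FP _ FX; apply; right.
have [X0 Xlin X1] := CX.
have [N HN] := submod_of_prop _ _ _ X0 Xlin.
have IN : {subset I <= N} by move=> x xI; apply/HN; left.
exists N => //; split; first by exists 1; apply/negP => /HN.
move=> J NJ [a aJ] x xJ; apply/HN; right; apply: contrapT => Xx.
apply: (Xmax [set` J]).
  split; last by move=> /(_ x xJ).
  by move=> y Xy; apply: NJ; apply/HN; right.
have -> : [set` I] `|` [set` J] = [set` J].
  by apply/setUidr => y yI; apply: NJ; exact: IN.
split=> /= [|c y z yJ zJ|J1]; first exact: rpred0.
  by apply: rpredD => //; exact: rpredZ.
by move/negP: aJ; apply; rewrite -[a]mul1r; exact: ideal_mul.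
Qed.

Lemma one_notin_maximal (N : submodClosed A^c^o) :
  maximal_right_ideal N -> (1 : A^c^o) \notin N.
Proof.
case=> [[a aN] _]; apply: contra aN => N1.
by rewrite -[a]mul1r; exact: ideal_mul.
Qed.

Lemma right_ideal_generated (I : submodClosed A^c^o) (a : A) :
  exists J : submodClosed A^c^o,
    forall x : A, (x : A^c^o) \in J <->
      exists2 m : A, (m : A^c^o) \in I & exists b, x = m + a * b.
Proof.
apply: (submod_of_prop A^c A^c^o) => [|c x y [m mI [b ->]] [m' m'I [b' ->]]].
  by exists 0; [exact: rpred0|exists 0; rewrite mulr0 addr0].
exists (m * c + m') => [|]; first by apply: ideal_add => //; exact: ideal_mul.
exists (b * c + b'); rewrite mulrDr mulrA addrACA -mulrDl //.
Qed.

Lemma maximal_comaximal (N : submodClosed A^c^o) (a : A) :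
  maximal_right_ideal N -> (a : A^c^o) \notin N ->
  exists2 m : A, (m : A^c^o) \in N & exists b, 1 = m + a * b.
Proof.
move=> Nmax aN; have [J HJ] := right_ideal_generated N a.
apply/HJ; apply: contrapT => J1; move/negP: aN; apply.
case: Nmax => _ /(_ J); apply.
- by move=> x xN; apply/HJ; exists x => //; exists 0; rewrite mulr0 addr0.
- by exists 1; exact/negP.
- by apply/HJ; exists 0; [exact: rpred0|exists 1; rewrite mulr1 add0r].
Qed.

(** Otherwise (1 - j) A lies in a maximal right ideal, which contains j and
therefore also 1. *)
Lemma Jac_right_inverse (j : A) : Jac j -> exists c, (1 - j) * c = 1.
Proof.
move=> jJ; have [Z HZ] := submod_of_prop A^c A^c^o (fun x => x = 0) erefl
  (fun c x y x0 y0 => etrans (f_equal2 (fun s t => c *: s + t) x0 y0)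
     (etrans (addr0 _) (scaler0 _ _))).
have [I HI] := right_ideal_generated Z (1 - j).
have [I1|I1] := boolP ((1 : A^c^o) \in I).
  have /HI[m mZ [c E]] := I1; exists c.
  by rewrite [RHS]E (proj1 (HZ m) mZ) add0r.
have [N Nmax IN] := proper_sub_maximal I I1.
case/negP: (one_notin_maximal N Nmax); rewrite -[1](subrK j).
apply: ideal_add; last exact: jJ.
apply/IN/HI; exists 0; first by apply/HZ.
by exists 1; rewrite add0r mulr1.
Qed.

End RightIdeals.

(** * Local idempotents of a semiperfect ring *)

Section LocalIdempotents.
Context {A : pzRingType}.

(** The corner ring e A e is local or zero: of two elements with sum e, one is
invertible.  This dichotomy is the form in which locality is used. *)
Definition local_idempotent (e : A) : Prop :=
  e * e = e /\ forall a, e * a = a -> a * e = a ->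
    exists b, [/\ e * b = b, b * e = b &
      (a * b = e /\ b * a = e) \/ ((e - a) * b = e /\ b * (e - a) = e)].

(** The two-sided ideal generated by the local idempotents. *)
Definition local_ideal (a : A) : Prop := exists2 s : seq (A * A * A),
  a = \sum_(t <- s) t.1.1 * t.1.2 * t.2 &
  forall t, t \in s -> local_idempotent t.1.2.

Lemma local_idealD (a b : A) :
  local_ideal a -> local_ideal b -> local_ideal (a + b).
Proof.
move=> [s -> sl] [t -> tl]; exists (s ++ t); first by rewrite big_cat.
by move=> x; rewrite mem_cat => /orP[/sl|/tl].
Qed.

Lemma local_idealMr (a b : A) : local_ideal a -> local_ideal (a * b).
Proof.
move=> [s -> sl]; exists [seq (t.1, t.2 * b) | t <- s].
  by rewrite big_map mulr_suml; apply: eq_bigr => t _; rewrite mulrA.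
by move=> _ /mapP[t /sl tl ->].
Qed.

(** If this ideal T were proper, it would lie in a maximal right ideal N.  The
image N' of N in A / Jac A has a complement S, which is simple; the component
of 1 in S is an idempotent, and it lifts to an idempotent f of A.  Then f lies
outside N although it is local, hence in T: an element of f A f outside the
radical lies outside N, so it is right invertible in f A f because N is
maximal, and right invertibility of all such elements makes them units. *)
Lemma semiperfect_local_ideal1 : semiperfect A -> local_ideal 1.
Proof.
case=> [[B [pi [pisurj piJ Bss]]] lift]; apply: contrapT => nT1.
have pi0 (a : A) : Jac a -> pi a = 0 by case: (piJ a).
have Jpi (a : A) : pi a = 0 -> Jac a by case: (piJ a).
have JM (a b : A) : Jac a -> Jac (a * b).
  by move=> aJ; have pa := pi0 _ aJ; apply: Jpi; rewrite rmorphM pa mul0r.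
have MJ (a b : A) : Jac a -> Jac (b * a).
  by move=> aJ; have pa := pi0 _ aJ; apply: Jpi; rewrite rmorphM pa mulr0.
have Junit (j : A) : Jac j -> exists c, (1 - j) * c = 1 /\ c * (1 - j) = 1.
  move=> jJ; have [c jc] := Jac_right_inverse j jJ.
  have cE : c = 1 - (- (j * c)).
    by rewrite opprK -[X in X + _]jc mulrBl mul1r subrK.
  have [|d cd] := Jac_right_inverse (- (j * c)).
    by apply: Jpi; rewrite rmorphN /= rmorphM (pi0 _ jJ) mul0r oppr0.
  rewrite -cE in cd; exists c; split=> //.
  by rewrite -cd; congr (_ * _); rewrite -[RHS]mul1r -jc -mulrA cd mulr1.
have [T HT] : exists T : submodClosed A^c^o,
    forall x, x \in T <-> local_ideal x.
  apply: submod_of_prop => [|c x y Tx Ty].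
    by exists [::]; rewrite ?big_nil.
  by apply: local_idealD => //; exact: local_idealMr.
have [|N Nmax TN] := proper_sub_maximal T; first by apply/negP => /HT.
have N1 := one_notin_maximal N Nmax.
have [N' HN'] : exists N' : submodClosed B^c^o,
    forall x, x \in N' <-> exists2 n : A, (n : A^c^o) \in N & pi n = x.
  apply: submod_of_prop => [|c x y [n nN <-] [n' n'N <-]].
    by exists 0; [exact: rpred0|exact: rmorph0].
  have [a <-] := pisurj c; exists (n * a + n'); last by rewrite rmorphD rmorphM.
  by apply: ideal_add => //; exact: ideal_mul.
have N'N n : (pi n : B^c^o) \in N' -> (n : A^c^o) \in N.
  case/HN' => n' n'N pn; rewrite -[n](subrK n'); apply: ideal_add => //.
  by apply: (Jpi (n - n') _ N Nmax); rewrite rmorphB /= pn subrr.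
have [S [Sdec Sdisj]] := Bss N'.
have [m' [eb [m'N' ebS one']]] : exists m' eb : B,
    [/\ (m' : B^c^o) \in N', (eb : B^c^o) \in S & 1 = m' + eb] := Sdec 1.
have mulS (b c : B) : (b : B^c^o) \in S -> (b * c : B^c^o) \in S.
  by move=> bS; exact: (@rpredZ B^c B^c^o S (c : B^c) b bS).
have mulN' (b c : B) : (b : B^c^o) \in N' -> (b * c : B^c^o) \in N'.
  by move=> bS; exact: (@rpredZ B^c B^c^o N' (c : B^c) b bS).
have m'e : m' * eb = 0.
  apply: Sdisj; first exact: mulN'.
  have -> : m' * eb = eb - eb * eb.
    by rewrite -[X in X - _]mul1r one' mulrDl addrK.
  by apply: ideal_sub => //; exact: mulS.
have ebI : eb * eb = eb.
  by rewrite -[RHS]mul1r one' mulrDl m'e add0r.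
(* eb is the idempotent of the quotient that projects onto S *)
have [a pa] := pisurj eb.
have [|f fI] := lift a.
  by apply: Jpi; rewrite rmorphB /= rmorphM pa ebI subrr.
move=> fJ; have := pi0 _ fJ.
rewrite rmorphB /= pa => /eqP; rewrite subr_eq0 => /eqP pf.
have fNN : (f : A^c^o) \notin N.
  apply/negP => fN; have eb0 : eb = 0.
    by apply: Sdisj => //; apply/HN'; exists f.
  move/negP: N1; apply; apply: N'N; rewrite rmorph1.
  by rewrite one' eb0 addr0.
have fN1 : (1 - f : A^c^o) \in N.
  by apply: N'N; rewrite rmorphB /= rmorph1 pf one' addrK.
suff floc : local_idempotent f.
  move/negP: fNN; apply; apply/TN/HT.
  exists [:: (1, f, 1)]; first by rewrite big_seq1 /= mulr1 mul1r.
  by move=> t; rewrite inE => /eqP ->.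
(* the image of f A is contained in S, which meets N' trivially *)
have NJ (x : A) : f * x = x -> (x : A^c^o) \in N -> Jac x.
  move=> fx xN; apply: Jpi; apply: Sdisj; first by apply/HN'; exists x.
  by rewrite -fx rmorphM pf; exact: mulS.
(* f - x is a unit of f A f when x in f A f is radical *)
have Jf (x : A) : f * x = x -> x * f = x -> Jac x ->
    exists b, [/\ f * b = b, b * f = b, (f - x) * b = f & b * (f - x) = f].
  move=> fx xf xJ; have [c [cr cl]] := Junit x xJ; exists (f * c).
  have E1 : f - x = f * (1 - x) by rewrite mulrBr mulr1 fx.
  have E2 : f - x = (1 - x) * f by rewrite mulrBl mul1r xf.
  have comm : f * c = c * f.
    by rewrite -[f * c]mul1r -cl mulrA -[c * _ * f]mulrA -E2 E1 -!mulrA cr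
      mulr1.
  split.
  - by rewrite mulrA fI.
  - by rewrite comm -mulrA fI.
  - by rewrite E2 -mulrA [f * (f * c)]mulrA fI comm mulrA cr mul1r.
  - by rewrite E2 -mulrA [c * _]mulrA cl mul1r fI.
have rinv (x : A) : f * x = x -> x * f = x -> ~ Jac x ->
    exists b, [/\ f * b = b, b * f = b & x * b = f].
  move=> fx xf xJ.
  have [|m mN [b one2]] := maximal_comaximal N x Nmax.
    by apply/negP => /NJ-/(_ fx).
  have fmJ : Jac (f * m).
    apply: NJ; first by rewrite mulrA fI.
    have -> : f * m = m - (1 - f) * m by rewrite mulrBl mul1r subKr.
    by apply: ideal_sub => //; exact: ideal_mul.
  have [|||c [fc cf cr _]] := Jf (f * m * f).
  - by rewrite !mulrA fI.
  - by rewrite -mulrA fI.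
  - exact: JM.
  exists (f * b * c); split; rewrite ?mulrA ?fI // -?mulrA ?cf //.
  have xb : x * b = f - f * m.
    have E : x * b = 1 - m by rewrite one2 [m + _]addrC addrK.
    by rewrite -{1}fx -mulrA E mulrBr mulr1.
  by rewrite -[RHS]cr [x * _]mulrA xf mulrA xb !mulrBl -[f * m * f * c]mulrA
    fc.
split=> // x fx xf.
case: (pselect (Jac x)) => xJ.
  by have [b [? ? ? ?]] := Jf x fx xf xJ; exists b; split=> //; right.
have [b [fb bf xb]] := rinv x fx xf xJ.
have bJ : ~ Jac b.
  move=> bJ; move/negP: fNN; apply; rewrite -xb; exact: (MJ b x bJ).
have [c [fc cf bc]] := rinv b fb bf bJ.
exists b; split=> //; left; split=> //.
have -> // : x = c by rewrite -xf -bc mulrA xb fc.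
Qed.

End LocalIdempotents.

(** * Right modules and their duals *)

Section RightModules.
Context {A : pzRingType} {M : lmodType A^c}.
Implicit Types (x y : M) (a b : A).

Lemma ractDl x y a : ract (x + y) a = ract x a + ract y a.
Proof. exact: scalerDr. Qed.

Lemma ractDr x a b : ract x (a + b) = ract x a + ract x b.
Proof. exact: scalerDl. Qed.

Lemma ractA x a b : ract (ract x a) b = ract x (a * b).
Proof. exact: (@scalerA A^c M b a x). Qed.

Lemma ract1 x : ract x 1 = x.
Proof. exact: scale1r. Qed.

Lemma ractx0 x : ract x 0 = 0.
Proof. exact: scale0r. Qed.

Lemma ract0x a : ract (0 : M) a = 0.
Proof. exact: scaler0. Qed.

Lemma ractNl x a : ract (- x) a = - ract x a.
Proof. exact: scalerN. Qed.

Lemma ractNr x a : ract x (- a) = - ract x a.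
Proof. exact: (@scaleNr A^c M a x). Qed.

Lemma ract_suml (I : Type) (r : seq I) (F : I -> M) a :
  ract (\sum_(i <- r) F i) a = \sum_(i <- r) ract (F i) a.
Proof. exact: scaler_sumr. Qed.

Lemma ract_sumr (I : Type) (r : seq I) (F : I -> A) x :
  ract x (\sum_(i <- r) F i) = \sum_(i <- r) ract x (F i).
Proof. exact: (big_morph (ract x) (ractDr x) (ractx0 x)). Qed.

Lemma linear_ract (N : lmodType A^c) (f : {linear M -> N}) x a :
  f (ract x a) = ract (f x) a.
Proof. exact: linearZ. Qed.

Lemma mem_ract (V : submodClosed M) x a : x \in V -> ract x a \in V.
Proof. exact: rpredZ. Qed.

Lemma mem_opp (V : submodClosed M) x : x \in V -> - x \in V.
Proof. by move=> xV; rewrite -[x]ract1 -ractNr; exact: mem_ract. Qed.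

Lemma mem_sub (V : submodClosed M) x y : x \in V -> y \in V -> x - y \in V.
Proof. by move=> xV yV; rewrite rpredD // mem_opp. Qed.

End RightModules.

Section Functionals.
Context {A : pzRingType} {M : lmodType A^c}.

Lemma module_dualP (f : M -> A) : module_dual M f <->
  (forall x y, f (x + y) = f x + f y) /\
  (forall x a, f (ract x a) = f x * a).
Proof.
split=> [fl|[fD fZ] c x y].
  have f0 : f 0 = 0.
    by have := fl (-1) 0 0; rewrite scaler0 add0r scaleN1r addNr.
  split=> [x y|x a].
    by have := fl 1 x y; rewrite scale1r => ->; congr (_ + _); exact: mulr1.
  by have := fl a x 0; rewrite addr0 f0 [RHS]addr0.
by rewrite fD -/(ract x c) fZ.
Qed.

Lemma dual_mull (f : M -> A) (a : A) : module_dual M f ->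
  module_dual M (fun x => a * f x).
Proof.
case/module_dualP => fD fZ; apply/module_dualP; split=> [x y|x b].
  by rewrite fD mulrDr.
by rewrite fZ mulrA.
Qed.

Lemma dual_add (f g : M -> A) : module_dual M f -> module_dual M g ->
  module_dual M (fun x => f x + g x).
Proof.
move=> /module_dualP[fD fZ] /module_dualP[gD gZ].
apply/module_dualP; split=> [x y|x b]; first by rewrite fD gD addrACA.
by rewrite fZ gZ mulrDl.
Qed.

End Functionals.

(** * Sesquilinear forms over a unitary ring *)

Section Isometries.
Context {A : pzRingType} {sigma : A -> A} {u : A} {Lambda : zmodClosed A}.
Context (hA : is_unitary_ring sigma u Lambda).
Context {P : lmodType A^c} {beta : P -> P -> A}.
Context (hbeta : is_sesquilinear sigma beta).

Local Notation h := (hform sigma u beta).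

Lemma sigmaD a b : sigma (a + b) = sigma a + sigma b.
Proof. by case: hA => [[[_ + _ _] _ _] _]; apply. Qed.

Lemma sigmaM a b : sigma (a * b) = sigma b * sigma a.
Proof. by case: hA => [[[_ _ _ +] _ _] _]; apply. Qed.

Lemma sigma1 : sigma 1 = 1.
Proof. by case: hA => [[[_ _ + _] _ _] _]; apply. Qed.

Lemma sigma0 : sigma 0 = 0.
Proof. by apply: (addrI (sigma 0)); rewrite -sigmaD !addr0. Qed.

Lemma sigmaN a : sigma (- a) = - sigma a.
Proof. by apply/eqP; rewrite -addr_eq0 -sigmaD addNr sigma0. Qed.

Lemma sigma_inj : injective sigma.
Proof. by case: hA => [[[+ _ _ _] _ _] _]; exact: bij_inj. Qed.

Lemma sigma_surj a : exists b, sigma b = a.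
Proof. by case: hA => [[[[g _ sgK] _ _ _] _ _] _]; exists (g a). Qed.

Lemma sigmauK : sigma u * u = 1.
Proof. by case: hA => [[_ + _] _]. Qed.

Lemma muluK : u * sigma u = 1.
Proof.
case: hA => [[_ su [u' [uu' u'u _]]] _].
have -> // : sigma u = u'.
by rewrite -[RHS]mul1r -su -mulrA uu' mulr1.
Qed.

Lemma sigmaK a : sigma (sigma a) = u * a * sigma u.
Proof.
case: hA => [[_ su [u' [uu' u'u ->]]] _]; congr (_ * _).
by rewrite -[LHS]mul1r -su -mulrA uu' mulr1.
Qed.

Lemma sesqE (W : lmodType A^c) (w : W -> W -> A) : is_sesquilinear sigma w ->
  [/\ forall x y z, w (x + y) z = w x z + w y z,
      forall x y z, w x (y + z) = w x y + w x z,
      forall x y a, w (ract x a) y = sigma a * w x y &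
      forall x y a, w x (ract y a) = w x y * a].
Proof.
case=> wDl wDr wZ; split=> // x y a.
  by rewrite -[y in LHS]ract1 wZ mulr1.
by rewrite -[x in LHS]ract1 wZ sigma1 mul1r.
Qed.

Lemma sesqN (W : lmodType A^c) (w : W -> W -> A) : is_sesquilinear sigma w ->
  (forall x y, w (- x) y = - w x y) /\ (forall x y, w x (- y) = - w x y).
Proof.
case/sesqE=> _ _ wZl wZr; split=> x y.
  by rewrite -[x]ract1 -ractNr !wZl sigmaN sigma1 mulN1r mul1r.
by rewrite -[y]ract1 -ractNr !wZr mulrN !mulr1.
Qed.

Lemma hform_sesq : is_sesquilinear sigma h.
Proof.
have [bDl bDr bZl bZr] := sesqE _ _ hbeta; rewrite /hform; split.
- by move=> x x' y; rewrite bDl bDr sigmaD mulrDl addrACA.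
- by move=> x y y'; rewrite bDl bDr sigmaD mulrDl addrACA.
move=> x y a b; rewrite !bZl !bZr !sigmaM sigmaK mulrDr mulrDl !mulrA.
by rewrite -[_ * b * sigma u * u]mulrA sigmauK mulr1.
Qed.

Lemma hDl x y z : h (x + y) z = h x z + h y z.
Proof. by have [+ _ _ _] := sesqE _ _ hform_sesq; apply. Qed.
Lemma hDr x y z : h x (y + z) = h x y + h x z.
Proof. by have [_ + _ _] := sesqE _ _ hform_sesq; apply. Qed.
Lemma hZl x y a : h (ract x a) y = sigma a * h x y.
Proof. by have [_ _ + _] := sesqE _ _ hform_sesq; apply. Qed.
Lemma hZr x y a : h x (ract y a) = h x y * a.
Proof. by have [_ _ _ +] := sesqE _ _ hform_sesq; apply. Qed.
Lemma h0l x : h 0 x = 0.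
Proof. by rewrite -(ractx0 0) hZl sigma0 mul0r. Qed.
Lemma h0r x : h x 0 = 0.
Proof. by rewrite -(ractx0 0) hZr mulr0. Qed.
Lemma hNl x y : h (- x) y = - h x y.
Proof. by have [+ _] := sesqN _ _ hform_sesq; apply. Qed.
Lemma hNr x y : h x (- y) = - h x y.
Proof. by have [_ +] := sesqN _ _ hform_sesq; apply. Qed.
Lemma h_sym x y : sigma (h x y) * u = h y x.
Proof.
rewrite /hform sigmaD sigmaM sigmaK mulrDl addrC; congr (_ + _).
by rewrite !mulrA sigmauK mul1r -mulrA sigmauK mulr1.
Qed.

Lemma Lambda_minP a : a - sigma a * u \in Lambda.
Proof. by case: hA => [_ [+ _ _]]; apply; exists a. Qed.

Lemma Lambda_maxP l : l \in Lambda -> sigma l * u = - l.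
Proof. by case: hA => [_ [_ + _]]; apply. Qed.

Lemma Lambda_conj a l : l \in Lambda -> sigma a * l * a \in Lambda.
Proof. by case: hA => [_ [_ _ +]]; apply. Qed.

(** * Reflections *)

(** Bijectivity is kept apart; the two clauses together are equivalent to
preservation of the quadratic class. *)
Definition isometric (phi : P -> P) : Prop :=
  (forall x y, h (phi x) (phi y) = h x y) /\
  (forall x, beta (phi x) (phi x) - beta x x \in Lambda).

(** Wall's construction of isometries.  Unimodularity of w is only required up
to the kernel of i, which is what lets W be free while the form lives on
corners cut out by idempotents.  The inverse isometry comes from the adjoint
form (x, y) |-> sigma(w(y, x)) u; this is where w needs to be nondegenerate,
and the functionals h(z, i -) representable, on the left as well. *)
Lemma unimodular_reflection (W : lmodType A^c) (i : {linear W -> P})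
    (w : W -> W -> A) :
  is_sesquilinear sigma w ->
  (forall x y, w x y + sigma (w y x) * u = h (i x) (i y)) ->
  (forall x, w x x - beta (i x) (i x) \in Lambda) ->
  (forall y, (forall x, w x y = 0) -> i y = 0) ->
  (forall x, (forall y, w x y = 0) -> i x = 0) ->
  (forall z, exists y, forall x, w x y = h (i x) z) ->
  (forall z, exists x, forall y, w x y = h z (i y)) ->
  exists phi : {linear P -> P}, [/\ bijective phi, isometric phi &
    forall z y, (forall x, w x y = h (i x) z) -> phi z = z - i y].
Proof.
move=> wS wh wL wr wl /choice[t tP] /choice[t' t'P].
have [wDl wDr wZl wZr] := sesqE _ _ wS.
have [_ wNr] := sesqN _ _ wS.
have uniq z y : (forall x, w x y = h (i x) z) -> i y = i (t z).
  move=> yP; apply/eqP; rewrite -subr_eq0 -linearB; apply/eqP/wr => x.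
  by rewrite wDr wNr yP tP subrr.
have fl : linear (fun z => z - i (t z)).
  move=> c x y; rewrite -(uniq (c *: x + y) (c *: t x + t y)).
    rewrite linearD linearZ opprD addrACA; congr (_ + _).
    by rewrite scalerBr.
  move=> z; rewrite -/(ract _ c) wDr wZr !tP -[c *: x]/(ract x c) hDr hZr //.
pose phi : {linear P -> P} := HB.pack (fun z => z - i (t z))
  (GRing.isLinear.Build _ _ _ _ _ fl).
exists phi; split; last by move=> z y /uniq /= ->.
  exists (fun z => z - i (t' z)) => z /=.
    suff -> : i (t' (z - i (t z))) = - i (t z) by rewrite opprK subrK.
    apply/eqP; rewrite -subr_eq0 opprK -linearD; apply/eqP/wl => y.
    rewrite wDl t'P hDl hNl -wh tP opprD h_sym.
    by rewrite addrCA subrr addr0 addNr.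
  suff -> : i (t (z - i (t' z))) = - i (t' z) by rewrite opprK subrK.
  apply/eqP; rewrite -subr_eq0 opprK -linearD; apply/eqP/wr => y.
  rewrite wDr tP hDr hNr -wh t'P opprD h_sym.
  by rewrite addrCA subrr addr0 addNr.
split=> [x y|x] /=.
  rewrite !(hDl, hDr, hNl, hNr) -wh !tP h_sym opprK.
  by rewrite addKr subrK.
have [bDl bDr bZl bZr] := sesqE _ _ hbeta.
have [bNl bNr] := sesqN _ _ hbeta.
rewrite !(bDl, bDr, bNl, bNr).
have Lw : beta (i (t x)) x + sigma (beta x (i (t x))) * u
    - beta (i (t x)) (i (t x)) \in Lambda by have := wL (t x); rewrite tP.
set L := (X in X \in _); set R := _ - beta (i (t x)) _ in Lw.
have -> : L = - R - (beta x (i (t x)) - sigma (beta x (i (t x))) * u).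
  rewrite /L /R !opprB opprK [LHS]addrAC [X in X + _ = _]addrAC subrr add0r.
  rewrite [RHS]addrA [- (_ + _)]opprD [X in _ = X + _ - _]addrA subrK.
  by rewrite addrC [- _ + _]addrC.
by apply: rpredB; [rewrite rpredN|exact: Lambda_minP].
Qed.

(** The conjugate-transpose rule for the involution b |-> sigma(b) u on the
entries of a Gram matrix. *)
Lemma star_conj a b c :
  sigma (sigma a * (b * c)) * u = sigma c * (sigma b * u * a).
Proof.
by rewrite !sigmaM sigmaK -!mulrA sigmauK mulr1.
Qed.

Lemma star_invol a : sigma (sigma a * u) * u = a.
Proof. by rewrite sigmaM sigmaK !mulrA sigmauK mul1r -mulrA sigmauK mulr1. Qed.

(** The case W = A x A with i(a1, a2) = d a1 + v a2 and Gram matrix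
(x, p; r, c). *)
Lemma reflection_along_pair (d v : P) (x p r c : A) :
  x + sigma x * u = h d d -> p + sigma r * u = h d v ->
  c + sigma c * u = h v v ->
  x - beta d d \in Lambda -> c - beta v v \in Lambda ->
  (forall b1 b2, x * b1 + p * b2 = 0 -> r * b1 + c * b2 = 0 ->
     ract d b1 + ract v b2 = 0) ->
  (forall a1 a2, sigma a1 * x + sigma a2 * r = 0 ->
     sigma a1 * p + sigma a2 * c = 0 -> ract d a1 + ract v a2 = 0) ->
  (forall z, exists b1 b2,
     x * b1 + p * b2 = h d z /\ r * b1 + c * b2 = h v z) ->
  (forall z, exists a1 a2,
     sigma a1 * x + sigma a2 * r = h z d /\
     sigma a1 * p + sigma a2 * c = h z v) ->
  exists phi : {linear P -> P}, [/\ bijective phi, isometric phi &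
    forall z b1 b2, x * b1 + p * b2 = h d z -> r * b1 + c * b2 = h v z ->
      phi z = z - (ract d b1 + ract v b2)].
Proof.
move=> hx hp hc Lx Lc ndr ndl sr sl.
have [bDl bDr bZl bZr] := sesqE _ _ hbeta.
pose W : lmodType A^c := (A^c^o * A^c^o)%type.
pose w (a b : W) : A := sigma (a.1 : A) * (x * b.1 + p * b.2)
  + sigma (a.2 : A) * (r * b.1 + c * b.2).
pose w' (a b : W) : A := (sigma (a.1 : A) * x + sigma (a.2 : A) * r) * b.1
  + (sigma (a.1 : A) * p + sigma (a.2 : A) * c) * b.2.
have wE a b : w a b = w' a b.
  by rewrite /w /w' !mulrDr !mulrDl !mulrA addrACA.
have il : linear (fun a : W => ract d (a.1 : A) + ract v (a.2 : A)).
  move=> k a b; have E (s : P) (m n : A) :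
      ract s (m * k + n) = ract (ract s m) k + ract s n.
    by rewrite ractA -ractDr.
  have -> : (k *: a + b).1 = (a.1 : A) * k + b.1 :> A by [].
  have -> : (k *: a + b).2 = (a.2 : A) * k + b.2 :> A by [].
  by rewrite !E addrACA -ractDl.
pose i : {linear W -> P} :=
  HB.pack (fun a : W => ract d (a.1 : A) + ract v (a.2 : A))
  (GRing.isLinear.Build _ _ _ _ _ il).
have iE a : i a = ract d (a.1 : A) + ract v (a.2 : A) by [].
have [|||||||phi [phib phii phiE]] := unimodular_reflection W i w.
- split=> [a a' b|a b b'|a b k l].
  + by rewrite /w /= !sigmaD !mulrDl addrACA.
  + rewrite !wE /w' /= !mulrDr addrACA //.
  + have e1 : (ract a k).1 = (a.1 : A) * k by [].
    have e2 : (ract a k).2 = (a.2 : A) * k by [].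
    have e3 : (ract b l).1 = (b.1 : A) * l by [].
    have e4 : (ract b l).2 = (b.2 : A) * l by [].
    by rewrite /w e1 e2 e3 e4 !sigmaM !(mulrDl, mulrDr) !mulrA.
- move=> a b; rewrite /w !mulrDr !sigmaD !mulrDl !star_conj iE.
  have -> : i b = ract d (b.1 : A) + ract v (b.2 : A) by [].
  have hp' : r + sigma p * u = h v d.
    by rewrite -(h_sym d v) -hp sigmaD mulrDl star_invol addrC.
  rewrite !(hDl, hDr, hZl, hZr) -hx -hp -hp' -hc.
  rewrite !(mulrDl, mulrDr) -!mulrA.
  rewrite [X in _ + X = _]addrACA [LHS]addrACA.
  by congr (_ + _); exact: addrACA.
- move=> a; rewrite iE !(bDl, bDr, bZl, bZr) /w !mulrDr.
  rewrite !opprD addrACA [X in X + _]addrACA [X in _ + X]addrACA.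
  rewrite -!mulrBr -!mulrBl -addrA.
  apply: rpredD; first by rewrite mulrA; exact: Lambda_conj.
  rewrite addrA; apply: rpredD; last by rewrite mulrA; exact: Lambda_conj.
  (* the two cross terms add up to an element of the form b - sigma(b) u *)
  have -> : p - beta d v = - (sigma (r - beta v d) * u).
    have -> : p = h d v - sigma r * u by rewrite -hp addrK.
    rewrite sigmaD mulrDl sigmaN mulNr opprB /hform addrAC.
    by rewrite [beta d v + _]addrC addrK.
  rewrite mulNr mulrN addrC -star_conj; exact: Lambda_minP.
- move=> b H; apply: ndr.
    by have := H ((1 : A), (0 : A)); rewrite /w /= sigma1 sigma0 mul0r
      mul1r addr0.
  by have := H ((0 : A), (1 : A)); rewrite /w /= sigma1 sigma0 mul0r mul1r
    add0r.
- move=> a H; apply: ndl.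
    by have := H ((1 : A), (0 : A)); rewrite wE /w' /= mulr0 mulr1 addr0.
  by have := H ((0 : A), (1 : A)); rewrite wE /w' /= mulr0 mulr1 add0r.
- move=> z; have [b1 [b2 [e1 e2]]] := sr z; exists (b1, b2) => a.
  by rewrite /w /= e1 e2 hDl !hZl.
- move=> z; have [a1 [a2 [e1 e2]]] := sl z; exists (a1, a2) => b.
  by rewrite wE /w' /= e1 e2 hDr !hZr.
exists phi; split=> // z b1 b2 e1 e2; rewrite (phiE z (b1, b2)) // => a.
by rewrite /w /= e1 e2 hDl !hZl.
Qed.

Lemma h_diag x y : beta x x - beta y y \in Lambda -> h x x = h y y.
Proof.
move/Lambda_maxP => E; apply/eqP; rewrite -subr_eq0 /hform opprD addrACA.
by rewrite -mulNr -mulrDl -sigmaN -sigmaD E subrr.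
Qed.

(** A reflection z |-> z - i(t z) sends q to s exactly when i(t q) = d, and
t q = (1, 0) forces the first column of the Gram matrix to be h(d, q), h(v, q).
The upper right entry is then forced by compatibility with h to be - h(s, v).
That h(d, q) is an admissible value of the quadratic form at d is precisely the
hypothesis that q and s have the same quadratic value. *)
Lemma reflection_moving (q s v : P) : let d := q - s in
  beta s s - beta q q \in Lambda ->
  (forall b1 b2, h d q * b1 - h s v * b2 = 0 ->
     h v q * b1 + beta v v * b2 = 0 -> ract d b1 + ract v b2 = 0) ->
  (forall a1 a2, sigma a1 * h d q + sigma a2 * h v q = 0 ->
     - (sigma a1 * h s v) + sigma a2 * beta v v = 0 ->
     ract d a1 + ract v a2 = 0) ->
  (forall z, exists b1 b2, h d q * b1 - h s v * b2 = h d z /\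
     h v q * b1 + beta v v * b2 = h v z) ->
  (forall z, exists a1 a2, sigma a1 * h d q + sigma a2 * h v q = h z d /\
     - (sigma a1 * h s v) + sigma a2 * beta v v = h z v) ->
  exists phi : {linear P -> P}, [/\ bijective phi, isometric phi, phi q = s,
    (forall V : submodClosed P, d \in V -> v \in V ->
       forall z, phi z - z \in V) &
    forall z, h d z = 0 -> h v z = 0 -> phi z = z].
Proof.
move=> d qs ndr ndl sr sl; have hqs := h_diag _ _ qs.
have [bDl bDr bZl bZr] := sesqE _ _ hbeta.
have [bNl bNr] := sesqN _ _ hbeta.
have [|||||||z1|z1|phi [phib phii phiE]] :=
  reflection_along_pair d v (h d q) (- h s v) (h v q) (beta v v).
- rewrite h_sym /d !(hDl, hDr, hNl, hNr) hqs opprK addrC.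
  by rewrite [- _ + _]addrC.
- by rewrite h_sym /d hDl hNl addrC.
- by [].
- have -> : h d q - beta d d = (- beta q d - sigma (- beta q d) * u)
      - (beta s s - beta q q).
    rewrite {2}/d bDr bNr /hform opprD opprK addrACA subrr add0r.
    rewrite sigmaN mulNr opprK [- _ + _]addrC opprB -addrA; congr (_ + _).
    by rewrite /d bDr bNr bDl bNl opprB addrA subrK.
  by apply: rpredB => //; exact: Lambda_minP.
- by rewrite subrr rpred0.
- by move=> b1 b2; rewrite mulNr; exact: ndr.
- by move=> b1 b2; rewrite mulrN; exact: ndl.
- by have [b1 [b2 H]] := sr z1; exists b1, b2; rewrite mulNr.
- by have [b1 [b2 H]] := sl z1; exists b1, b2; rewrite mulrN.
exists phi; split=> //.
- rewrite (phiE q 1 0); rewrite ?mulr1 ?mulr0 ?addr0 //.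
  by rewrite ract1 ractx0 addr0 /d subKr.
- move=> V dV vV z; have [b1 [b2 [e1 e2]]] := sr z.
  rewrite (phiE z b1 b2) ?mulNr // addrC addKr; apply: mem_opp.
  by rewrite rpredD // mem_ract.
- move=> z dz vz; rewrite (phiE z 0 0) ?mulr0 ?addr0 //.
  by rewrite !ractx0 addr0 subr0.
Qed.

(** x (y sigma(e)) corresponds under sigma to an idempotent of the local ring
e A e, hence is 0 or sigma(e), and it is nonzero unless e is. *)
Lemma local_inverse (e x y : A) : local_idempotent e -> e * y = y ->
  x * e = x -> sigma e * x = x -> y * x = e -> x * (y * sigma e) = sigma e.
Proof.
move=> [eI eloc] ey xe ex yx; have [z zE] := sigma_surj (x * (y * sigma e)).
have seI : sigma e * sigma e = sigma e by rewrite -sigmaM eI.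
have ez : e * z = z.
  by apply: sigma_inj; rewrite sigmaM zE -!mulrA seI.
have ze : z * e = z.
  by apply: sigma_inj; rewrite sigmaM zE mulrA ex.
have zz : z * z = z.
  apply: sigma_inj; rewrite sigmaM zE -!mulrA [sigma e * (x * _)]mulrA ex.
  by rewrite [y * (x * _)]mulrA yx [e * (y * _)]mulrA ey.
rewrite -zE; congr sigma.
have [b [eb be [[zb bz]|[]]]] := eloc z ez ze.
  by rewrite -ze -zb mulrA zz.
move=> H _; have z0 : z = 0.
  by rewrite -ze -H mulrA mulrBr ze zz subrr mul0r.
have xy0 : x * (y * sigma e) = 0 by rewrite -zE z0 sigma0.
suff -> : e = 0 by [].
rewrite -eI -yx -{2}ex -mulrA [y * (_ * x)]mulrA [x * (_ * x)]mulrA xy0.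
by rewrite mul0r mulr0.
Qed.

(** * Moving a vector over a local idempotent *)

(** One reflection suffices, along d = q - s alone if h(d, q) is invertible,
and along d and a vector v that pairs invertibly with q and s otherwise. *)
Lemma extension_rank_one (e : A) (q s v1 v2 : P) : local_idempotent e ->
  ract q e = q -> ract s e = s -> beta s s - beta q q \in Lambda ->
  h v1 q = e -> h v2 s = e ->
  exists phi : {linear P -> P}, [/\ bijective phi, isometric phi, phi q = s,
    (forall V : submodClosed P, q - s \in V -> v1 \in V -> v2 \in V ->
       forall z, phi z - z \in V) &
    forall z, h (q - s) z = 0 -> h v1 z = 0 -> h v2 z = 0 -> phi z = z].
Proof.
move=> eloc qe se qs v1q v2s; have [eI el] := eloc.
(* the idempotent with sigma(g) = e, so that h(v g, -) = e h(v, -) *)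
pose g := sigma u * sigma e * u.
have sg : sigma g = e.
  by rewrite /g !sigmaM !sigmaK !mulrA sigmauK mul1r -!mulrA muluK
    mulr1 sigmauK mulr1.
have gI : g * g = g by apply: sigma_inj; rewrite sigmaM sg.
set d := q - s.
have de : ract d e = d by rewrite ractDl ractNl qe se.
have ex : sigma e * h d q = h d q by rewrite -hZl de.
have xe : h d q * e = h d q by rewrite -hZr qe.
(* If v1 does not pair invertibly with s, nor v2 with q, then v1 - v2 pairs
   with q and s by units up to sign, because e A e is local. *)
have [v [vg vV vz [r' [er' r'e qr qr']] [k' [ek' k'e sk sk']]]] : exists v : P,
    [/\ ract v g = v,
      forall V : submodClosed P, v1 \in V -> v2 \in V -> v \in V,
      forall z, h v1 z = 0 -> h v2 z = 0 -> h v z = 0,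
      exists b, [/\ e * b = b, b * e = b, h v q * b = e & b * h v q = e] &
      exists b, [/\ e * b = b, b * e = b, h v s * b = e & b * h v s = e]].
  have gE w : ract (ract w g) g = ract w g by rewrite ractA gI.
  have hg w z : h (ract w g) z = e * h w z by rewrite hZl sg.
  have [b [eb be [[b1 b2]|[b1 b2]]]] := el (e * h v1 s)
    ltac:(by rewrite mulrA eI) ltac:(by rewrite -mulrA -hZr se).
    exists (ract v1 g); split=> //.
    - by move=> V ? _; exact: mem_ract.
    - by move=> z E _; rewrite hg E mulr0.
    - by exists e; rewrite hg v1q !eI.
    - by exists b; rewrite hg.
  have [c [ec ce [[c1 c2]|[c1 c2]]]] := el (e * h v2 q)
    ltac:(by rewrite mulrA eI) ltac:(by rewrite -mulrA -hZr qe).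
    exists (ract v2 g); split=> //.
    - by move=> V _ ?; exact: mem_ract.
    - by move=> z _ E; rewrite hg E mulr0.
    - by exists c; rewrite hg.
    - by exists e; rewrite hg v2s !eI.
  exists (ract (v1 - v2) g); split=> //.
  - by move=> V ? ?; apply: mem_ract; exact: mem_sub.
  - by move=> z E1 E2; rewrite hg hDl hNl E1 E2 subrr mulr0.
  - by exists c; rewrite hg hDl hNl v1q mulrBr eI.
  - exists (- b); rewrite hg hDl hNl v2s mulrBr eI.
    by rewrite -[_ - e]opprB !(mulrN, mulNr) !opprK eb be.
pose c := beta v v.
have cg : c * g = c.
  by rewrite /c; have [_ _ _ <-] := sesqE _ _ hbeta; rewrite vg.
have ec : e * c = c.
  by rewrite /c -{1}sg; have [_ _ <- _] := sesqE _ _ hbeta; rewrite vg.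
(* p' inverts h s v between the corners of sigma(e) and g *)
pose p' := sigma u * sigma k'.
have hsv : h s v = sigma (h v s) * u by rewrite h_sym.
have pp' : h s v * p' = sigma e.
  by rewrite hsv /p' -mulrA [u * _]mulrA muluK mul1r -sigmaM sk'.
have p'p : p' * h s v = g.
  by rewrite hsv /p' mulrA -[_ * _ * sigma (h v s)]mulrA -sigmaM sk.
have p'e : p' * sigma e = p' by rewrite /p' -mulrA -sigmaM ek'.
clearbody p'.
have re : h v q * e = h v q by rewrite -hZr qe.
(* the Schur complement is h v q * (e - alpha), so either it is invertible or
   alpha is; in the latter case h d q has a left inverse *)
pose alpha := - (r' * c * p' * h d q).
have ea : e * alpha = alpha by rewrite /alpha mulrN !mulrA er'.
have ae : alpha * e = alpha by rewrite /alpha mulNr -mulrA xe.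
have [b [eb be [[_ ba]|[ab ba]]]] := el alpha ea ae.
  pose y := - (b * (r' * c * p')).
  have yx : y * h d q = e by rewrite -ba /y /alpha mulrN mulNr !mulrA.
  have ye : y * sigma e = y by rewrite /y mulNr -!mulrA p'e.
  have ey : e * y = y by rewrite /y mulrN mulrA eb.
  have xy : h d q * y = sigma e.
    by rewrite -(local_inverse e (h d q) y eloc ey xe ex yx) ye.
  have b00 : beta 0 0 = 0.
    by have [_ _ _ bZr] := sesqE _ _ hbeta; rewrite -{2}(ractx0 0) bZr mulr0.
  have [b1 b2|a1 a2|z|z|phi [phib phii phiq phiV phi1]] :=
    reflection_moving q s 0 qs; rewrite ?h0l ?h0r ?b00 -/d.
  - rewrite mul0r subr0 => xb _; rewrite ract0x addr0.
    by rewrite -de ractA -yx -mulrA xb mulr0 ractx0.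
  - rewrite !mulr0 addr0 => ax _; rewrite ract0x addr0.
    suff ea1 : e * a1 = 0 by rewrite -de ractA ea1 ractx0.
    by apply: sigma_inj; rewrite sigmaM -xy mulrA ax mul0r sigma0.
  - exists (y * h d z), 0; rewrite !mul0r subr0 addr0; split=> //.
    by rewrite mulrA xy -hZl de.
  - have [a aE] := sigma_surj (h z d * y); exists a, 0.
    rewrite aE !mulr0 oppr0 !addr0; split=> //.
    by rewrite -mulrA yx -hZr de.
  exists phi; split=> // [V dV _ _|z dz _ _].
    by apply: phiV => //; exact: rpred0.
  by apply: phi1 => //; rewrite h0l.
(* m is the Schur complement of the entry - h s v *)
pose m := h v q + c * p' * h d q.
have mE : m = h v q * (e - alpha).
  rewrite /m /alpha mulrBr re mulrN opprK; congr (_ + _).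
  by rewrite !mulrA qr ec.
pose m' := b * r'.
have mm' : m * m' = e.
  by rewrite mE /m' mulrA -[_ * _ * b]mulrA ab re qr.
have m'm : m' * m = e.
  by rewrite mE /m' -mulrA [r' * _]mulrA qr' [e * _]mulrBr eI ea ba.
have [b1 b2 E1 E2|a1 a2 E1 E2|z|z|phi [phib phii phiq phiV phi1]] :=
    reflection_moving q s v qs; rewrite -/d.
- have gb2 : g * b2 = p' * h d q * b1.
    by move/(congr1 (fun t => p' * t)): E1; rewrite mulrBr mulr0 !mulrA p'p
      => /eqP; rewrite subr_eq0 => /eqP <-.
  have eb1 : e * b1 = 0.
    by rewrite -m'm -mulrA mulrDl -[c * p' * _ * _]mulrA -mulrA [p' * _]mulrA
      -gb2 [c * (g * _)]mulrA cg E2 mulr0.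
  have db1 : h d q * b1 = 0 by rewrite -xe -mulrA eb1 mulr0.
  by rewrite -de -vg !ractA eb1 gb2 -mulrA db1 mulr0 !ractx0 addr0.
- have a1E : sigma a1 * sigma e = sigma a2 * c * p'.
    move/(congr1 (fun t => t * p')): E2; rewrite mulrDl mul0r mulNr.
    by rewrite -mulrA pp' addrC => /eqP; rewrite subr_eq0 => /eqP <-.
  have a2e : sigma a2 * e = 0.
    by rewrite -mm' mulrA /m mulrDr !mulrA -a1E -[_ * sigma e * _]mulrA ex
      addrC E1 !mul0r.
  have ga2 : g * a2 = 0 by apply: sigma_inj; rewrite sigmaM sg a2e sigma0.
  have ea1 : e * a1 = 0.
    by apply: sigma_inj; rewrite sigmaM a1E -ec mulrA a2e !mul0r sigma0.
  by rewrite -de -vg !ractA ea1 ga2 !ractx0 addr0.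
- pose b1 := m' * (h v z + c * p' * h d z).
  exists b1, (p' * (h d q * b1 - h d z)); split.
    rewrite mulrA pp' mulrBr mulrA ex -hZl de subKr //.
  have mb1 : m * b1 = h v z + c * p' * h d z.
    rewrite /b1 mulrA mm' mulrDr !mulrA ec; congr (_ + _).
    by rewrite -{1}sg -hZl vg.
  move: mb1; rewrite mulrDl => mb1.
  rewrite mulrA mulrBr addrA [c * p' * (_ * _)]mulrA mb1 addrK //.
- pose n := h z d + h z v * p' * h d q.
  have [a2 a2E] := sigma_surj (n * m').
  have [a1 a1E] := sigma_surj ((sigma a2 * c - h z v) * p').
  have hzd : h z d * e = h z d by rewrite -hZr de.
  have hzv : h z v * g = h z v by rewrite -hZr vg.
  have a2m : sigma a2 * m = n.
    by rewrite a2E -mulrA m'm /n mulrDl hzd -[_ * _ * e]mulrA xe.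
  exists a1, a2; split; last first.
    rewrite a1E -[_ * p' * _]mulrA p'p mulrBl hzv -mulrA cg opprB.
    by rewrite subrK.
  rewrite a1E !mulrBl addrAC; apply/eqP; rewrite subr_eq -/n -a2m /m.
  by rewrite [X in _ == X]mulrDr !mulrA addrC.
exists phi; split=> // [V dV v1V v2V|z dz v1z v2z].
  by apply: phiV => //; exact: vV.
by apply: phi1 => //; exact: vz.
Qed.

(** * Induction over a dual basis *)

(** The maps a and b stand for the inclusion of Q and for psi.  Only the span
of the x k shrinks in the induction, not M, so the hypotheses on a and b, in
particular surjectivity onto the dual of all of M, remain available: they
provide vectors of V whose pairing with the image of M is any prescribed
functional. *)
Lemma extension_on_span (M : lmodType A^c) (a b : {linear M -> P})
    (V : submodClosed P) :
  (forall x y, h (b x) (b y) = h (a x) (a y)) ->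
  (forall x, beta (b x) (b x) - beta (a x) (a x) \in Lambda) ->
  (forall x, b x - a x \in V) ->
  (forall f, module_dual M f ->
     exists2 v, v \in V & forall x, h v (a x) = f x) ->
  (forall f, module_dual M f ->
     exists2 v, v \in V & forall x, h v (b x) = f x) ->
  forall (n : nat) (x : 'I_n -> M) (f : 'I_n -> M -> A) (e : 'I_n -> A),
    (forall k, local_idempotent (e k)) ->
    (forall k, ract (x k) (e k) = x k) ->
    (forall k, module_dual M (f k)) ->
    (forall k m, e k * f k m = f k m) ->
    (forall l, x l = \sum_k ract (x k) (f k (x l))) ->
  exists phi : {linear P -> P}, [/\ bijective phi, isometric phi,
    forall k, phi (a (x k)) = b (x k) & forall z, phi z - z \in V].
Proof.
move=> hab bab abV ontoa ontob; elim=> [|n IH] x f e el xe fl ef xE.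
  exists idfun; split=> [||[]//|z]; first by exists id.
    by split=> // z; rewrite subrr rpred0.
  by rewrite subrr rpred0.
pose t k := lift (@ord0 n) k.
have [eI eloc] := el ord0.
have [fD fZ] : (forall y z, f ord0 (y + z) = f ord0 y + f ord0 z) /\
  (forall y c, f ord0 (ract y c) = f ord0 y * c) by apply/module_dualP.
have fe : f ord0 (x ord0) * e ord0 = f ord0 (x ord0) by rewrite -fZ xe.
have [c [ec ce H]] := eloc _ (ef ord0 (x ord0)) fe.
case: H => [[fc cf]|[fc cf]].
(* x 0 spans a summand with coordinate g; pr projects onto the kernel of g *)
- pose g m := c * f ord0 m.
  have gl : module_dual M g by exact: dual_mull.
  have [gD gZ] : (forall y z, g (y + z) = g y + g z) /\
    (forall y c, g (ract y c) = g y * c) by apply/module_dualP.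
  have gx0 : g (x ord0) = e ord0 by [].
  have eg m : e ord0 * g m = g m by rewrite /g mulrA ec.
  pose pr m := m - ract (x ord0) (g m).
  have prD y z : pr (y + z) = pr y + pr z.
    by rewrite /pr gD ractDr opprD addrACA.
  have prZ y d : pr (ract y d) = ract (pr y) d.
    by rewrite /pr gZ -ractA ractDl ractNl.
  have pr0 : pr (x ord0) = 0 by rewrite /pr gx0 xe subrr.
  have gpr m : g (pr m) = 0.
    rewrite /pr -ractNr gD gZ gx0 mulrN eg subrr //.
  have prpr m : pr (pr m) = pr m by rewrite {1}/pr gpr ractx0 subr0.
  have prsum (F : 'I_n.+1 -> M) : pr (\sum_k F k) = \sum_k pr (F k).
    apply: (big_morph pr prD).
    by rewrite /pr -(ractx0 0) gZ mulr0 !ractx0 subr0.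
  have [|||||phi1 [bij1 [iso1 iso1L] phi1x phi1V]] :=
    IH (fun k => pr (x (t k))) (fun k => f (t k)) (fun k => e (t k)).
  + by move=> k; exact: el.
  + by move=> k; rewrite -prZ xe.
  + by move=> k; exact: fl.
  + by move=> k m; exact: ef.
  + move=> l; rewrite -[LHS]prpr.
    have {1}-> : pr (x (t l)) = \sum_k ract (x k) (f k (pr (x (t l)))).
      rewrite {1}/pr {1}(xE (t l)) {1}(xE ord0) ract_suml -sumrB.
      apply: eq_bigr => k _; rewrite ractA -ractNr -ractDr; congr ract.
      have [kD kZ] : (forall y z, f k (y + z) = f k y + f k z) /\
        (forall y c, f k (ract y c) = f k y * c) by apply/module_dualP.
      by rewrite /pr kD -ractNr kZ mulrN.
    rewrite prsum big_ord_recl prZ pr0 ract0x add0r.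
    by apply: eq_bigr => k _; rewrite prZ.
  have [v vV vE] := ontoa g gl; have [v' v'V v'E] := ontob g gl.
  pose q := phi1 (a (x ord0)); pose s := b (x ord0).
  have [|||||phi2 [bij2 [iso2 iso2L] phi2q phi2V phi2id]] :=
    extension_rank_one (e ord0) q s (phi1 v) v' (el ord0).
  + by rewrite /q -!linear_ract xe.
  + by rewrite /s -!linear_ract xe.
  + have := rpredB (bab (x ord0)) (iso1L (a (x ord0))).
    by rewrite opprB addrA subrK.
  + by rewrite iso1 vE.
  + by rewrite v'E.
  (* the vectors used for phi2 are orthogonal to what phi1 has settled *)
  have bq k : phi2 (b (pr (x (t k)))) = b (pr (x (t k))).
    apply: phi2id.
    * by rewrite hDl hNl -[X in h q X]phi1x /q iso1 hab subrr.
    * by rewrite -phi1x iso1 vE gpr.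
    * by rewrite v'E gpr.
  have qsV : q - s \in V.
    have := mem_sub V _ _ (phi1V (a (x ord0))) (abV (x ord0)).
    by rewrite opprB addrA subrK.
  exists (phi2 \o phi1); split=> [||k|z] /=.
  + exact: bij_comp.
  + split=> [y z|z] /=; first by rewrite iso2 iso1.
    by have := rpredD (iso2L (phi1 z)) (iso1L z); rewrite addrA subrK.
  + have phi0 : phi2 (phi1 (a (x ord0))) = b (x ord0) by exact: phi2q.
    case: (unliftP ord0 k) => [j ->|-> //].
    rewrite -[x _](subrK (ract (x ord0) (g (x (t j))))) -/(pr (x (t j))).
    by rewrite [a _]linearD [phi1 _]linearD [phi2 _]linearD [b _]linearD
      phi1x bq !linear_ract phi0.
  + have := rpredD (phi2V V qsV _ v'V (phi1 z)) (phi1V z).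
    rewrite addrA subrK; apply.
    by rewrite -[phi1 v](subrK v) rpredD.
(* x 0 is a combination of the other x k, so f 0 can be absorbed by them *)
- have x0E : x ord0 = \sum_k ract (x (t k)) (f (t k) (x ord0) * c).
    rewrite -[LHS]xe -fc -ractA ractDr ractNr xe {1}(xE ord0) big_ord_recl.
    by rewrite addrC addKr ract_suml; apply: eq_bigr => k _; rewrite ractA.
  have [|||||phi [bijp isop phix phiV]] := IH (fun k => x (t k))
    (fun k m => f (t k) m + f (t k) (x ord0) * c * f ord0 m)
    (fun k => e (t k)).
  + by move=> k; exact: el.
  + by move=> k; exact: xe.
  + by move=> k; apply: dual_add; [exact: fl|apply: dual_mull; exact: fl].
  + by move=> k m; rewrite mulrDr !mulrA !ef.
  + move=> l; rewrite {1}xE big_ord_recl {1}x0E ract_suml -big_split /=.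
    by apply: eq_bigr => k _; rewrite ractA -ractDr addrC.
  exists phi; split=> // k; case: (unliftP ord0 k) => [j ->|->].
    exact: phix.
  rewrite x0E !linear_sum /=; apply: eq_bigr => j _.
  by rewrite !linear_ract phix.
Qed.

(** Rearranged, the off-diagonal condition for membership in Lambda_P says that
h is preserved. *)
Lemma hform_eqE x y x' y' : beta x' y' - beta x y =
  - (sigma (beta y' x' - beta y x) * u) <-> h x' y' = h x y.
Proof.
rewrite /hform sigmaD sigmaN mulrDl mulNr.
split=> [/eqP|/eqP]; last rewrite -subr_eq0 opprD addrACA.
  by rewrite -addr_eq0 addrACA -opprD subr_eq0 => /eqP.
by rewrite addr_eq0 => /eqP.
Qed.

Lemma isometric_same_class (phi : {linear P -> P}) : isometric phi ->
  same_class sigma u Lambda (fun x y => beta (phi x) (phi y)) beta.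
Proof.
case=> iso isoL; have [bDl bDr bZ] := hbeta.
split=> [|x y|//]; last by apply/hform_eqE.
split=> [x x' y|x y y'|x y a b].
- by rewrite linearD !bDl opprD addrACA.
- by rewrite linearD !bDr opprD addrACA.
- by rewrite !linear_ract !bZ mulrBr mulrBl.
Qed.

End Isometries.

(** * Dual bases of summands *)

Section DualBases.
Context {A : pzRingType}.

Definition dual_basis {M : lmodType A^c} {I : finType} (x : I -> M)
    (f : I -> M -> A) : Prop :=
  (forall k, module_dual M (f k)) /\ forall m, m = \sum_k ract (x k) (f k m).

Lemma fg_projective_dual_basis (M : lmodType A^c) : fg_projective M ->
  exists (n : nat) (x : 'I_n -> M) (f : 'I_n -> M -> A), dual_basis x f.
Proof.
case=> [[n [x xgen]] Mproj].
pose comb (c : 'rV[A^c]_n) : M := \sum_k ract (x k) (c ord0 k).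
have combl : linear comb.
  move=> a c d; rewrite /comb scaler_sumr -big_split; apply: eq_bigr => k _ /=.
  by rewrite !mxE /ract scalerDl scalerA.
pose g : {linear 'rV[A^c]_n -> M} :=
  HB.pack comb (GRing.isLinear.Build _ _ _ _ _ combl).
have [|s sP] := Mproj _ _ g idfun.
  move=> m; have [c ->] := xgen m; exists (\row_k c k).
  by apply: eq_bigr => k _; rewrite mxE.
exists n, x, (fun k m => s m ord0 k); split=> [k|m]; last by rewrite -[LHS]sP.
by move=> a m m'; rewrite linearP !mxE.
Qed.

Lemma summand_dual_basis (M : lmodType A^c) (Q : submodClosed M)
    (I : finType) (x : I -> M) (f : I -> M -> A) :
  is_summand Q -> dual_basis x f ->
  exists y : I -> submod Q, dual_basis y (fun k m => f k (val m)).
Proof.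
case=> Q' [QQ' QQ'0] [fl xf].
have /choice[y yP] k : exists y : submod Q, x k - val y \in Q'.
  have [y [z [yQ zQ' ->]]] := QQ' (x k).
  by exists (exist _ y yQ); rewrite addrC addKr.
exists y; split=> [k|m].
  move=> a m m'; exact: (fl k a (val m) (val m')).
apply: val_inj; apply/eqP; rewrite -subr_eq0; apply/eqP/QQ'0.
  by apply: mem_sub; exact: valP.
pose emb : {linear submod Q -> M} := val.
rewrite {1}[val m]xf -[X in _ - X]/(emb _) linear_sum -sumrB.
apply: rpred_sum => k _.
by rewrite [emb _]linear_ract -ractNl -ractDl; apply: mem_ract; exact: yP.
Qed.

(** Writing 1 as a sum of terms a e b with e a local idempotent splits each
term x f(m) of an expansion into terms (x a e) (e b f(m)). *)
Lemma local_dual_basis (M : lmodType A^c) (I : finType) (x : I -> M)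
    (f : I -> M -> A) : local_ideal (1 : A) -> dual_basis x f ->
  exists (n : nat) (y : 'I_n -> M) (g : 'I_n -> M -> A) (e : 'I_n -> A),
  [/\ forall k, local_idempotent (e k), forall k, ract (y k) (e k) = y k,
      forall k m, e k * g k m = g k m & dual_basis y g].
Proof.
move=> [s sE sl] [fl xf].
pose t (j : 'I_(size s)) := tnth (in_tuple s) j.
have el j : local_idempotent (t j).1.2 by apply: sl; exact: mem_tnth.
pose K : finType := (I * 'I_(size s))%type.
pose y (k : K) := ract (x k.1) ((t k.2).1.1 * (t k.2).1.2).
pose g (k : K) m := (t k.2).1.2 * (t k.2).2 * f k.1 m.
exists #|K|, (y \o enum_val), (g \o enum_val),
  (fun k => (t (enum_val k).2).1.2).
have eI k : (t k).1.2 * (t k).1.2 = (t k).1.2 by have [] := el k.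
split=> [k|k|k m|]; first exact: el.
- by rewrite /= /y ractA -mulrA eI.
- by rewrite /= /g !mulrA eI.
split=> [k|m]; first by apply: dual_mull; exact: fl.
transitivity (\sum_i \sum_j ract (y (i, j)) (g (i, j) m)).
  rewrite [LHS]xf; apply: eq_bigr => i _.
  rewrite -[f i m]mul1r {1}sE (big_tnth _ _ s) mulr_suml ract_sumr.
  apply: eq_bigr => j _; rewrite /y /g ractA /= -/(t j); congr ract.
  by rewrite !mulrA -[_ * (t j).1.2 * (t j).1.2]mulrA eI.
rewrite pair_bigA -(big_enum_val (A := K) (fun k => ract (y k) (g k m))).
by apply: eq_big => [k|[i j] _].
Qed.

End DualBases.

(** * The extension theorem *)

Theorem theorem4p8 (A : pzRingType) (sigma : A -> A) (u : A)
    (Lambda : zmodClosed A)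
    (hA : is_unitary_ring sigma u Lambda) (hsp : semiperfect A)
    (P : lmodType A^c) (hP : fg_projective P)
    (beta : P -> P -> A) (hbeta : is_sesquilinear sigma beta)
    (Q S V : submodClosed P)
    (hQ : is_summand Q) (hS : is_summand S) (hV : is_summand V)
    (psi : {linear submod Q -> submod S})
    (hpsi : is_isometry sigma u Lambda (restr Q beta) (restr S beta) psi)
    (h1aQ : [set Lmap sigma u beta Q x | x in [set` V]] = module_dual (submod Q))
    (h1aS : [set Lmap sigma u beta S x | x in [set` V]] = module_dual (submod S))
    (h1b : forall x : submod Q, val (psi x) - val x \in V) :
  exists phi : {linear P -> P},
    [/\ is_isometry sigma u Lambda beta beta phi,
        forall x : submod Q, phi (val x) = val (psi x)
      & forall x : P, phi x - x \in V].
Proof.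
have [n0 [x0 [f0 xf0]]] := fg_projective_dual_basis P hP.
have [x1 xf1] := summand_dual_basis P Q _ x0 f0 hQ xf0.
have [n [x [f [e [el xe ef [fl xf]]]]]] :=
  local_dual_basis _ _ _ _ (semiperfect_local_ideal1 hsp) xf1.
pose a : {linear submod Q -> P} := val.
pose b : {linear submod Q -> P} := val \o psi.
have [psib [_ psih psiL]] := hpsi.
have hab y z : hform sigma u beta (b y) (b z) = hform sigma u beta (a y) (a z).
  by apply/(hform_eqE hA); exact: psih.
have ontoa g : module_dual (submod Q) g ->
    exists2 v, v \in V & forall y, hform sigma u beta v (a y) = g y.
  by rewrite -h1aQ => -[v vV <-]; exists v.
have ontob g : module_dual (submod Q) g ->
    exists2 v, v \in V & forall y, hform sigma u beta v (b y) = g y.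
  have [psi' psiK psi'K] := psib.
  move=> /module_dualP[gD gZ].
  have : module_dual (submod S) (g \o psi').
    apply/module_dualP; split=> [y z|y c] /=; rewrite -?gD -?gZ; congr g.
      by apply: (can_inj psiK); rewrite linearD !psi'K.
    by apply: (can_inj psiK); rewrite linear_ract !psi'K.
  rewrite -h1aS => -[v vV vE]; exists v => // y.
  by rewrite -[y in RHS]psiK -[RHS]/((g \o psi') (psi y)) -vE.
have [phi [phib phii phix phiV]] :=
  extension_on_span hA hbeta _ a b V hab psiL h1b ontoa ontob n x f e
    el xe fl ef (fun l => xf (x l)).
exists phi; split=> // [|y]; first by split=> //; exact: isometric_same_class.
change (phi (a y) = b y).
rewrite [y]xf (linear_sum a) (linear_sum phi) (linear_sum b).
by apply: eq_bigr => k _; rewrite !linear_ract phix.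
Qed.
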